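(* Let $A=(a_{ij})$ be a $2\times4$ matrix of real functions of $(x,y)$ on an open set of $\mathbb R^2$. Suppose that there are functions $b_1,b_2,b_3,b_4$ of $(x,y)$ such that $F_1=(-b_2,b_1)$ and $F_2=(-b_4,b_3)$ are conservative vector fields with potential functions $\varphi_1$ and $\varphi_2$, respectively (that is, $\nabla\varphi_i=F_i$), and such that the system $\langle A:dw\rangle=0$ is equivalent to the system $$b_1u_x+b_2u_y=0,\qquad b_3v_x+b_4v_y=0.$$ Then the $\varphi\mathbb A$-differentiable functions $w=(u,v)$ are solutions of $\langle A:dw\rangle=0$, where $\varphi=(\varphi_1,\varphi_2)$ and $\mathbb A=\mathbb A^2_{1,2}$.
   Context: For $w=(u,v)$, $\langle A:dw\rangle=0$ denotes the system $a_{i1}u_x+a_{i2}u_y+a_{i3}v_x+a_{i4}v_y=0$, $i=1,2$. Two homogeneous systems with coefficient matrices $A_1,A_2$ are equivalent if there is a $2\times2$ matrix valued function $M=M(x,y)$, nonsingular at every point, with $A_2=MA_1$. $\mathbb A^2_{1,2}$ is $\mathbb R^2$ with the commutative bilinear product $e_1e_1=e_1$, $e_1e_2=0$, $e_2e_2=e_2$. A function $f:U\subset\mathbb R^2\to\mathbb R^2$, differentiable in the usual sense, is $\varphi\mathbb A$-differentiable if there is a function $f'_\varphi:U\to\mathbb R^2$ such that $df_p(\xi)=f'_\varphi(p)\,d\varphi_p(\xi)$ ($\mathbb A$-product) for all $p\in U$, $\xi\in\mathbb R^2$. *)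

(* Defs.v *)
From HB Require Import structures.
From mathcomp Require Import all_boot all_order all_algebra.
From mathcomp Require Import all_classical all_reals all_analysis.

Set Implicit Arguments.
Unset Strict Implicit.
Unset Printing Implicit Defensive.

Import Order.TTheory GRing.Theory Num.Theory.
Import numFieldNormedType.Exports.

Local Open Scope classical_set_scope.
Local Open Scope ring_scope.

Section Defs.
Variable R : realType.

(* Points of the plane are row vectors: the coordinates (x, y) of p are
   p 0 0 and p 0 1.  Functions are total, but every predicate below only
   constrains them on the open set U. *)
Local Notation plane := 'rV[R]_2.

Definition row2 (a b : R) : plane := \row_(j < 2) [:: a; b]`_j.

Definition basis2 (j : 'I_2) : plane := delta_mx 0 j.

Definition partial2 (j : 'I_2) (g : plane -> R) (p : plane) : R :=
  'D_(basis2 j) g p.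

Definition gradient2 (g : plane -> R) (p : plane) : plane :=
  \row_(j < 2) partial2 j g p.

(* The differentiability clause is needed because derivatives are total
   functions, with junk values where the limit does not exist. *)
Definition is_potential (U : set plane) (F : plane -> plane)
    (g : plane -> R) : Prop :=
  forall p, U p -> differentiable g p /\ gradient2 g p = F p.

Definition component (i : 'I_2) (w : plane -> plane) (p : plane) : R :=
  w p 0 i.

(* Solutions of <A : dw> = 0 on U, with w = (u, v): the four first-order
   partial derivatives exist and satisfy both equations at every point. *)
Definition is_solution (U : set plane) (A : plane -> 'M[R]_(2, 4))
    (w : plane -> plane) : Prop :=
  let u := component 0 w in
  let v := component 1 w in
  forall p, U p ->
    (forall j : 'I_2, derivable u p (basis2 j) /\ derivable v p (basis2 j)) /\
    forall i : 'I_2,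
      A p i 0 * partial2 0 u p + A p i 1 * partial2 1 u p
      + A p i 2 * partial2 0 v p + A p i 3 * partial2 1 v p = 0.

Definition equivalent_systems (U : set plane)
    (A1 A2 : plane -> 'M[R]_(2, 4)) : Prop :=
  exists M : plane -> 'M[R]_2,
    forall p, U p -> M p \in unitmx /\ A2 p = M p *m A1 p.

(* Coefficient matrix of  b1 u_x + b2 u_y = 0,  b3 v_x + b4 v_y = 0. *)
Definition decoupled (b1 b2 b3 b4 : plane -> R) (p : plane) : 'M[R]_(2, 4) :=
  \matrix_(i < 2, j < 4)
    (nth [::] [:: [:: b1 p; b2 p; 0;    0   ];
                  [:: 0;    0;    b3 p; b4 p]] i)`_j.

(* The product of the algebra A^2_{1,2}: the bilinear extension of
   e1 e1 = e1, e1 e2 = e2 e1 = 0, e2 e2 = e2. *)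
Definition A12_mul (x y : plane) : plane :=
  \sum_(i < 2) \sum_(j < 2)
    (x 0 i * y 0 j) *: (if i == j then basis2 i else 0).

(* Differentiability of f with respect to phi and the algebra on R^2 whose
   product is mul; phi is understood to be differentiable on U. *)
Definition phiA_differentiable (mul : plane -> plane -> plane)
    (phi : plane -> plane) (U : set plane) (f : plane -> plane) : Prop :=
  (forall p, U p -> differentiable f p) /\
  exists f' : plane -> plane,
    forall p, U p -> forall xi : plane,
      'd f p xi = mul (f' p) ('d phi p xi).

End Defs.

(* Main.v *)
(* The product of A^2_{1,2} is componentwise, so phiA-differentiability says that
   grad u = c1 grad phi1 = c1 (-b2, b1) and grad v = c2 grad phi2 = c2 (-b4, b3).
   These are orthogonal to (b1, b2) and (b3, b4), so w solves the decoupled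
   system; multiplying by the inverse of M gives the original one. *)
Require Import Defs.
From HB Require Import structures.
From mathcomp Require Import all_boot all_order all_algebra.
From mathcomp Require Import all_classical all_reals all_analysis.
From mathcomp Require Import ring.

Set Implicit Arguments.
Unset Strict Implicit.
Unset Printing Implicit Defensive.

Import Order.TTheory GRing.Theory Num.Theory.
Import numFieldNormedType.Exports.

Local Open Scope classical_set_scope.
Local Open Scope ring_scope.

Lemma differentiable_component (R : realType) (i : 'I_2)
    (w : 'rV[R]_2 -> 'rV[R]_2) (p : 'rV[R]_2) :
  differentiable w p -> differentiable (component i w) p.
Proof.
move=> dw.
exact: (differentiable_comp dw (differentiable_coord (w p) 0 i)).
Qed.

Lemma partial2_component (R : realType) (i j : 'I_2)
    (w : 'rV[R]_2 -> 'rV[R]_2) (p : 'rV[R]_2) :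
  differentiable w p ->
  partial2 j (component i w) p = ('d w p (basis2 R j)) 0 i.
Proof.
by move=> dw; rewrite -deriveE // derive_mx ?mxE //; exact: diff_derivable.
Qed.

(** The basis vectors are orthogonal idempotents, so only the diagonal terms of the double sum
    survive, and the one at [i] alone reaches coordinate [i]. *)
Lemma A12_mulE (R : realType) (x y : 'rV[R]_2) (i : 'I_2) :
  A12_mul x y 0 i = x 0 i * y 0 i.
Proof.
rewrite /A12_mul summxE (bigD1 i) //= summxE (bigD1 i) //= !mxE eqxx.
rewrite /basis2 !mxE !eqxx mulr1 big1 ?addr0 => [|j ji]; last first.
  by rewrite eq_sym (negbTE ji) scaler0 mxE.
rewrite big1 ?addr0 // => j ji; rewrite summxE big1 // => k _.
(* For [j] different from [i], the term is either a multiple of [basis2 j], whose coordinate [i]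
   vanishes, or a multiple of 0. *)
by case: eqP => _; rewrite !mxE ?mulr0 // [i == j]eq_sym (negbTE ji) mulr0.
Qed.

(** [phiA_differentiable] does not assert that [phi] is differentiable; this lemma recovers it from
    the two potentials, so that ['d phi p] really computes partial derivatives. *)
Lemma differentiable_row2 (R : realType) (f g : 'rV[R]_2 -> R)
    (p : 'rV[R]_2) :
  differentiable f p -> differentiable g p ->
  differentiable (fun q => row2 (f q) (g q)) p.
Proof.
move=> df dg.
have -> : (fun q => row2 (f q) (g q)) =
    (fun q => f q *: basis2 R 0) + (fun q => g q *: basis2 R 1).
  apply/funext => q; apply/rowP => j; rewrite /basis2 !mxE.
  by case: j => -[|[|//]] h /=; rewrite !(mulr1, mulr0, addr0, add0r).
by apply: differentiableD; exact: differentiableZl.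
Qed.

(** Evaluate the differential identity at [basis2 R j] and read coordinate [i]. The factor [c 0 i]
    does not depend on [j], which makes the gradients of the [i]-th components parallel. *)
Lemma partial2_phiA (R : realType) (phi w : 'rV[R]_2 -> 'rV[R]_2)
    (c p : 'rV[R]_2) (i j : 'I_2) :
  differentiable w p -> differentiable phi p ->
  (forall xi, 'd w p xi = A12_mul c ('d phi p xi)) ->
  partial2 j (component i w) p = c 0 i * partial2 j (component i phi) p.
Proof.
move=> dw dphi dE.
rewrite (partial2_component i j dw) (partial2_component i j dphi).
exact: etrans (congr1 (fun z : 'rV[R]_2 => z 0 i) (dE _)) (A12_mulE _ _ _).
Qed.

Lemma is_potential_partial2 (R : realType) (U : set 'rV[R]_2)
    (a b g : 'rV[R]_2 -> R) (p : 'rV[R]_2) :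
  is_potential U (fun q => row2 (a q) (b q)) g -> U p ->
  partial2 0 g p = a p /\ partial2 1 g p = b p.
Proof.
by move=> Fg /Fg[_ /rowP gE]; split; [have := gE 0 | have := gE 1]; rewrite !mxE.
Qed.

Lemma component0_row2 (R : realType) (f g : 'rV[R]_2 -> R) :
  component 0 (fun q => row2 (f q) (g q)) = f.
Proof. by apply/funext => q; rewrite /component mxE. Qed.

Lemma component1_row2 (R : realType) (f g : 'rV[R]_2 -> R) :
  component 1 (fun q => row2 (f q) (g q)) = g.
Proof. by apply/funext => q; rewrite /component mxE. Qed.

Theorem proposition2p4 (R : realType) (U : set 'rV[R]_2)
  (A : 'rV[R]_2 -> 'M[R]_(2, 4))
  (b1 b2 b3 b4 phi1 phi2 : 'rV[R]_2 -> R) :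
  open U ->
  is_potential U (fun p => row2 (- b2 p) (b1 p)) phi1 ->
  is_potential U (fun p => row2 (- b4 p) (b3 p)) phi2 ->
  equivalent_systems U A (decoupled b1 b2 b3 b4) ->
  forall w : 'rV[R]_2 -> 'rV[R]_2,
    phiA_differentiable (@A12_mul R) (fun p => row2 (phi1 p) (phi2 p)) U w ->
    is_solution U A w.
Proof.
move=> _ pot1 pot2 [M eqM] w [dw [c dwE]]; rewrite /is_solution /= => p Up.
have dphi : differentiable (fun q => row2 (phi1 q) (phi2 q)) p.
  by apply: differentiable_row2; [case: (pot1 p Up) | case: (pot2 p Up)].
have part i j := partial2_phiA i j (dw p Up) dphi (dwE p Up).
have [phi1x phi1y] := is_potential_partial2 pot1 Up.
have [phi2x phi2y] := is_potential_partial2 pot2 Up.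
split=> [j|i].
  by split; apply/diff_derivable/differentiable_component/dw.
have [Munit AE] := eqM p Up.
(* Stacking the four partial derivatives in a column turns a system with matrix [B] into
   [B *m D = 0], on which [M p] acts by left multiplication. *)
pose D : 'cV[R]_4 := \col_j [:: partial2 0 (component 0 w) p;
  partial2 1 (component 0 w) p; partial2 0 (component 1 w) p;
  partial2 1 (component 1 w) p]`_j.
have rowE (B : 'M[R]_(2, 4)) k : (B *m D) k 0 =
    B k 0 * partial2 0 (component 0 w) p + B k 1 * partial2 1 (component 0 w) p
  + B k 2 * partial2 0 (component 1 w) p + B k 3 * partial2 1 (component 1 w) p.
  rewrite mxE !big_ord_recr big_ord0 /= add0r !mxE /=.
  (* The column indices produced by [big_ord_recr] agree with the literals 0, 1, 2, 3 only in
     value. *)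
  by congr (B k _ * _ + B k _ * _ + B k _ * _ + B k _ * _); exact: val_inj.
rewrite -rowE; suff -> : A p *m D = 0 by rewrite mxE.
rewrite -[A p *m D](mulKmx Munit) (mulmxA (M p)) -AE.
suff -> : decoupled b1 b2 b3 b4 p *m D = 0 by rewrite mulmx0.
apply/colP => k; rewrite rowE !part component0_row2 component1_row2 phi1x phi1y phi2x phi2y.
rewrite !mxE.
(* With [c p] = (c1, c2), row 0 is b1 c1 (-b2) + b2 c1 b1 and row 1 is b3 c2 (-b4) + b4 c2 b3. *)
by case: k => -[|[|//]] h /=; ring.
Qed.
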